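(* Let $l'(\mathbf{x},\mathbf{e})=\sum_{j=1}^m s_j(\mathbf{x})\,e_j$ be the scaled linear part of the roundoff error associated to a polynomial $f$ in $n$ variables, with multi-degree $\mathbf{d}$ in $\mathbf{x}$ (see context). For each multi-index $\mathbf{k}\in\mathbb{N}^n$ with $\mathbf{k}\geq\mathbf{d}$, set $$\overline{l'_{\mathbf{k}}} := \max_{\boldsymbol{\alpha}\leq\mathbf{k}}\ \sum_{j=1}^m \bigl|b_{\boldsymbol{\alpha}}^{(s_j)}\bigr|,\qquad \underline{l'_{\mathbf{k}}} := -\,\overline{l'_{\mathbf{k}}},$$ where $b_{\boldsymbol{\alpha}}^{(s_j)}$ denotes the Bernstein coefficients of multi-degree $\mathbf{k}$ of $s_j$. Then the polynomial $l'$ is bounded as follows: $$\underline{l'_{\mathbf{k}}}\ \leq\ l'(\mathbf{x},\mathbf{e})\ \leq\ \overline{l'_{\mathbf{k}}},\qquad \forall (\mathbf{x},\mathbf{e})\in\mathbf{X}\times\mathbf{E},$$ where $\mathbf{X}=[0,1]^n$ and $\mathbf{E}=[-1,1]^m$.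
   Context: Roundoff setting. A program implements a polynomial expression $f\in\mathbb{R}[\mathbf{x}]$, $\mathbf{x}=(x_1,\dots,x_n)$, built from variables and real constants with the operations $+,-,\times$; the input set is $\mathbf{X}=[0,1]^n$. In the simple rounding model, one error variable $e_j$ is introduced for each input variable $x_i$ or constant and for each arithmetic operation: each variable, constant, or result of an operation is multiplied by a factor $(1+e_j)$. With $\mathbf{e}=(e_1,\dots,e_m)$ the vector of all error variables, this yields a polynomial $\hat f(\mathbf{x},\mathbf{e})$ (the rounded expression) with $\hat f(\mathbf{x},\mathbf{0})=f(\mathbf{x})$. The error variables range over $[-\varepsilon,\varepsilon]$, with $\varepsilon>0$ the machine epsilon. Put $r(\mathbf{x},\mathbf{e}):=\hat f(\mathbf{x},\mathbf{e})-f(\mathbf{x})$, $s_j(\mathbf{x}):=\frac{\partial r}{\partial e_j}(\mathbf{x},\mathbf{0})$ for $j=1,\dots,m$, and $l(\mathbf{x},\mathbf{e}):=\sum_{j=1}^m s_j(\mathbf{x})\,e_j$. After dividing each error variable by $\varepsilon$, the scaled linear part $l'=l/\varepsilon$ is $l'(\mathbf{x},\mathbf{e})=\sum_{j=1}^m s_j(\mathbf{x})\,e_j$ with the scaled error variables $\mathbf{e}\in\mathbf{E}=[-1,1]^m$. Multi-degree. $\mathbf{d}=(d_1,\dots,d_n)$ is the multi-degree of $l'$ viewed as a polynomial in $\mathbf{x}$ with $\mathbf{e}$ as parameters, i.e. $d_i$ is the largest exponent of $x_i$ occurring in $l'$. Inequalities between multi-indices are componentwise. Bernstein coefficients. For $\mathbf{k}\in\mathbb{N}^n$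 and $\boldsymbol{\alpha}\leq\mathbf{k}$, let $\mathbf{B}_{\mathbf{k},\boldsymbol{\alpha}}(\mathbf{x}):=\prod_{i=1}^n\binom{k_i}{\alpha_i}x_i^{\alpha_i}(1-x_i)^{k_i-\alpha_i}$. For a polynomial $p(\mathbf{x})=\sum_{\boldsymbol{\gamma}}a_{\boldsymbol{\gamma}}\mathbf{x}^{\boldsymbol{\gamma}}$ of multi-degree at most $\mathbf{k}$, its Bernstein coefficients $b_{\boldsymbol{\alpha}}^{(p)}$ of multi-degree $\mathbf{k}$ are the unique reals such that $p(\mathbf{x})=\sum_{\boldsymbol{\alpha}\leq\mathbf{k}}b_{\boldsymbol{\alpha}}^{(p)}\mathbf{B}_{\mathbf{k},\boldsymbol{\alpha}}(\mathbf{x})$; explicitly $b_{\boldsymbol{\alpha}}^{(p)}=\sum_{\boldsymbol{\beta}\leq\boldsymbol{\alpha}}\frac{\binom{\boldsymbol{\alpha}}{\boldsymbol{\beta}}}{\binom{\mathbf{k}}{\boldsymbol{\beta}}}a_{\boldsymbol{\beta}}$, where $\binom{\boldsymbol{\alpha}}{\boldsymbol{\beta}}=\prod_{i=1}^n\binom{\alpha_i}{\beta_i}$. *)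

(* Defs.v *)
(* A realFieldType stands for the reals; polynomials are the formal ones of
   multinomials, with formal partial derivatives. *)
From HB Require Import structures.
From mathcomp Require Import all_boot all_order all_algebra.
From mathcomp.multinomials Require Export mpoly.

Set Implicit Arguments.
Unset Strict Implicit.
Unset Printing Implicit Defensive.

Import Order.TTheory GRing.Theory Num.Theory.
Local Open Scope ring_scope.

Inductive arith_op := OpAdd | OpSub | OpMul.

Definition eval_op (A : pzRingType) (o : arith_op) (u v : A) : A :=
  match o with OpAdd => u + v | OpSub => u - v | OpMul => u * v end.

(* A leaf [Cst j] denotes entry j of a table of q real constants.  Two leaves
   with the same index share one error variable; since the table may hold a
   value several times, occurrences of equal constants may also be given
   separate error variables. *)
Inductive expr (n q : nat) :=
  | Var of 'I_n
  | Cst of 'I_q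
  | Op of arith_op & expr n q & expr n q.
Arguments Var {n q}.
Arguments Cst {n q}.

Fixpoint nops n q (t : expr n q) : nat :=
  if t is Op _ t1 t2 then (nops t1 + nops t2).+1 else 0.

(* One error variable for each input variable, each constant and each
   operation of the program, in this order. *)
Definition nerr n q (t : expr n q) : nat := n + q + nops t.

Section Rounding.
Variables (R : realFieldType) (n q : nat).
Implicit Types (c : 'I_q -> R) (t : expr n q).

Fixpoint exact_poly c t : {mpoly R[n]} :=
  match t with
  | Var i => 'X_i
  | Cst j => (c j)%:MP
  | Op o t1 t2 => eval_op o (exact_poly c t1) (exact_poly c t2)
  end.

(* [X i], [EX i] and [EC j] are the input variable i, its error variable and
   the error variable of constant j.  [EO] supplies the error variables of the
   operations of t in prefix order: the root first, then the operations of the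
   left operand, then those of the right operand. *)
Fixpoint round_with N (X EX : 'I_n -> {mpoly R[N]}) (EC : 'I_q -> {mpoly R[N]})
    c t : ('I_(nops t) -> {mpoly R[N]}) -> {mpoly R[N]} :=
  match t return ('I_(nops t) -> {mpoly R[N]}) -> {mpoly R[N]} with
  | Var i => fun _ => X i * (1 + EX i)
  | Cst j => fun _ => (c j)%:MP * (1 + EC j)
  | Op o t1 t2 => fun EO : 'I_(nops t1 + nops t2).+1 -> {mpoly R[N]} =>
      eval_op o
        (@round_with N X EX EC c t1 (fun k => EO (lift ord0 (lshift (nops t2) k))))
        (@round_with N X EX EC c t2 (fun k => EO (lift ord0 (rshift (nops t1) k))))
      * (1 + EO ord0)
  end.

(* Polynomials in (x, e) are polynomials in n + m variables: x_i is the
   variable [lshift m i] and e_j is the variable [rshift n j]. *)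
Definition inx m (p : {mpoly R[n]}) : {mpoly R[n + m]} :=
  p \mPo [tuple 'X_(lshift m i) | i < n].

Definition at_e0 m (p : {mpoly R[n + m]}) : {mpoly R[n]} :=
  p \mPo [tuple (match split i with inl i' => 'X_i' | inr _ => 0 end) | i < n + m].

Definition point m (x : 'I_n -> R) (e : 'I_m -> R) (i : 'I_(n + m)) : R :=
  match split i with inl i' => x i' | inr j => e j end.

Definition rounded_poly c t : {mpoly R[n + nerr t]} :=
  let E j : {mpoly R[n + nerr t]} := 'X_(rshift n j) in
  round_with (fun i => 'X_(lshift (nerr t) i))
             (fun i => E (lshift (nops t) (lshift q i)))
             (fun j => E (lshift (nops t) (rshift n j)))
             c (fun k => E (rshift (n + q) k)).

Definition roundoff c t : {mpoly R[n + nerr t]} :=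
  rounded_poly c t - inx (nerr t) (exact_poly c t).

Definition s_poly c t (j : 'I_(nerr t)) : {mpoly R[n]} :=
  at_e0 ((roundoff c t)^`M(rshift n j)).

(* Since l is homogeneous of degree 1 in e, the scaled linear part
   l(x, eps e) / eps is, for every machine epsilon eps, this same polynomial
   sum; only the range of the error variables changes, to [-1, 1]. *)
Definition lin_part c t : {mpoly R[n + nerr t]} :=
  \sum_(j < nerr t) inx (nerr t) (s_poly c j) * 'X_(rshift n j).

Definition multidegree_x m (p : {mpoly R[n + m]}) : 'X_{1..n} :=
  [multinom \max_(mu <- msupp p) mu (lshift m i) | i < n].

Definition mbinom (a b : 'X_{1..n}) : nat := \prod_(i < n) 'C(a i, b i).

(* The bound on the total degree only makes the index type finite: it holds
   for every beta <= alpha. *)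
Definition bernstein_coeff (k : 'X_{1..n}) (p : {mpoly R[n]}) (alpha : 'X_{1..n}) : R :=
  \sum_(beta : 'X_{1..n < (mdeg alpha).+1} | (beta <= alpha)%MM)
     (mbinom alpha beta)%:R / (mbinom k beta)%:R * p@_beta.

(* The default value 0 does not affect the maximum: the sums are nonnegative
   and alpha = 0 is always in the range. *)
Definition upper_bound c t (k : 'X_{1..n}) : R :=
  \big[Num.max/0]_(alpha : 'X_{1..n < (mdeg k).+1} | (alpha <= k)%MM)
     \sum_(j < nerr t) `|bernstein_coeff k (s_poly c j) alpha|.

Definition lower_bound c t (k : 'X_{1..n}) : R := - upper_bound c t k.

End Rounding.

(* Main.v *)
(* Extracting the coefficient of x^beta e_j in l' shows that every monomial of
   s_j has multi-degree at most d, hence at most k.  Therefore s_j(x) is the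
   combination of its Bernstein coefficients with weights B_{k,alpha}(x), which
   are nonnegative on the unit box and sum to 1; since |e_j| <= 1, |l'(x,e)| is
   at most the same convex combination of the sums over j of the absolute
   values of these coefficients. *)
Require Import Defs.
From mathcomp Require Import all_boot all_order all_algebra.
From mathcomp.multinomials Require Import ssrcomplements.
From mathcomp Require Import ring.

Set Implicit Arguments.
Unset Strict Implicit.
Unset Printing Implicit Defensive.

Import Order.TTheory GRing.Theory Num.Theory.
Local Open Scope ring_scope.

(** Multiplied by [b! (a - b)! (k - a)!], both sides become [k!]. *)
Lemma mul_bin_bin (k a b : nat) : (b <= a <= k)%N ->
  ('C(k, a) * 'C(a, b) = 'C(k, b) * 'C(k - b, a - b))%N.
Proof.
case/andP=> ba ak; have bk := leq_trans ba ak.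
have f_gt0 : (0 < b`! * (a - b)`! * (k - a)`!)%N by rewrite !muln_gt0 !fact_gt0.
apply/eqP; rewrite -(eqn_pmul2r f_gt0); apply/eqP.
have E1 := bin_fact ak; have E2 := bin_fact ba; have E3 := bin_fact bk.
have := bin_fact (leq_sub2r b ak); rewrite subnBA // subnK // => E4.
transitivity k`!; first by rewrite -E1 -E2; ring.
by rewrite -E3 -E4; ring.
Qed.

Lemma leq_mdeg n (a b : 'X_{1..n}) : (a <= b)%MM -> (mdeg a <= mdeg b)%N.
Proof. by move=> /mnm_lepP ab; rewrite !mdegE; apply: leq_sum. Qed.

Section Bernstein.
Variable R : realFieldType.

Definition bern (k a : nat) (x : R) : R :=
  'C(k, a)%:R * x ^+ a * (1 - x) ^+ (k - a).

Lemma bern_ge0 k a x : 0 <= x <= 1 -> 0 <= bern k a x.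
Proof.
by case/andP=> x0 x1; rewrite !mulr_ge0 ?ler0n ?exprn_ge0 ?subr_ge0.
Qed.

Lemma bern_small k a x : (k < a)%N -> bern k a x = 0.
Proof. by move=> ka; rewrite /bern bin_small // !mul0r. Qed.

(** Binomial expansion of [x^b ((1 - x) + x)^(k - b)]: its term of index i is the Bernstein term of
    index [a = i + b], by [mul_bin_bin]. Summing up to any [N > k] lets all coordinates share one
    index range later. *)
Lemma expr_bern (k b N : nat) (x : R) : (b <= k < N)%N ->
  x ^+ b = \sum_(a < N) 'C(a, b)%:R / 'C(k, b)%:R * bern k a x.
Proof.
case/andP=> bk kN; pose F a := 'C(a, b)%:R / 'C(k, b)%:R * bern k a x.
(* Only [b <= a <= k] contributes: [bern k a x] vanishes above k, ['C(a, b)] below b. *)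
rewrite -(big_mkord xpredT F) (big_cat_nat (n := k.+1)) //=.
rewrite [X in _ + X]big1_seq ?addr0; last first.
  move=> a; rewrite mem_index_iota => /andP[_ /andP[ka _]].
  by rewrite /F bern_small ?mulr0.
rewrite (big_cat_nat (n := b)) //=; last exact: leqW.
rewrite [X in X + _]big1_seq ?add0r; last first.
  move=> a; rewrite mem_index_iota => /andP[_ /andP[_ ab]].
  by rewrite /F bin_small ?mul0r.
rewrite (big_addn 0 k.+1 b) subSn // big_mkord.
transitivity (x ^+ b * ((1 - x) + x) ^+ (k - b)).
  by rewrite subrK expr1n mulr1.
rewrite exprDn mulr_sumr; apply: eq_bigr => i _.
have ik : (i + b <= k)%N by rewrite addnC -leq_subRL // -ltnS ltn_ord.
have C0 : 'C(k, b)%:R != 0 :> R by rewrite pnatr_eq0 -lt0n bin_gt0.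
have := @mul_bin_bin k (i + b) b; rewrite leq_addl ik addnK => /(_ isT).
move/(congr1 (fun n => n%:R : R)); rewrite !natrM => CC.
rewrite /F /bern -[_ *+ 'C(_, _)]mulr_natl (addnC i b) subnDA exprD.
rewrite addnC in CC; apply: (mulfI C0).
rewrite mulrA [X in _ = X]mulrA (mulrCA _ _ (_^-1)) divff // mulr1.
transitivity ('C(k, b)%:R * 'C(k - b, i)%:R * (x ^+ b * x ^+ i) *
              (1 - x) ^+ (k - b - i)).
  by ring.
by rewrite -CC; ring.
Qed.

Lemma sum_bern (k N : nat) (x : R) : (k < N)%N -> \sum_(a < N) bern k a x = 1.
Proof.
move=> kN; rewrite -(expr0 x) (@expr_bern k 0 N) //.
by apply: eq_bigr => a _; rewrite !bin0 divff ?oner_eq0 // mul1r.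
Qed.

Variables (n N : nat) (k : 'X_{1..n}) (x : 'I_n -> R).
Hypothesis kN : forall i, (k i < N)%N.

(** Finite functions are the indices produced by distributing a product of sums over the
    coordinates. *)
Definition mnm_of_ffun (f : {ffun 'I_n -> 'I_N}) : 'X_{1..n} :=
  [multinom (f i : nat) | i < n].

(* The finite index set is the cube [0, N)^n, which contains all alpha <= k;
   the weight of an index that is not below k is 0. *)
Definition mbern (f : {ffun 'I_n -> 'I_N}) : R :=
  \prod_i bern (k i) (f i) (x i).

Lemma mbern_ge0 f : (forall i, 0 <= x i <= 1) -> 0 <= mbern f.
Proof. by move=> hx; apply: prodr_ge0 => i _; exact: bern_ge0. Qed.

Lemma sum_mbern : \sum_f mbern f = 1.
Proof.
rewrite -(bigA_distr_bigA (fun i (a : 'I_N) => bern (k i) a (x i))).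
by apply: big1 => i _; exact: sum_bern.
Qed.

Lemma mbern_eq0 f : ~~ (mnm_of_ffun f <= k)%MM -> mbern f = 0.
Proof.
move=> Nfk; have [i ki] : exists i, (k i < f i)%N.
  apply/existsP; apply: contraR Nfk; rewrite negb_exists => /forallP h.
  by apply/mnm_lepP => i; rewrite mnmE leqNgt.
by rewrite /mbern (bigD1 i) //= bern_small ?mul0r.
Qed.

Lemma mexpr_mbern (b : 'X_{1..n}) : (b <= k)%MM ->
  \prod_i x i ^+ b i =
  \sum_f (mbinom (mnm_of_ffun f) b)%:R / (mbinom k b)%:R * mbern f.
Proof.
move=> /mnm_lepP bk.
under eq_bigr => i _ do rewrite (@expr_bern (k i) (b i) N) ?bk ?kN //.
rewrite bigA_distr_bigA /=; apply: eq_bigr => f _.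
rewrite 2!big_split /= prodfV -!natr_prod; congr (_%:R / _ * _).
by apply: eq_bigr => i _; rewrite mnmE.
Qed.

Lemma mbinom_eq0 (a b : 'X_{1..n}) : ~~ (b <= a)%MM -> mbinom a b = 0%N.
Proof.
move=> Nba; have [i ai] : exists i, (a i < b i)%N.
  apply/existsP; apply: contraR Nba; rewrite negb_exists => /forallP h.
  by apply/mnm_lepP => i; rewrite leqNgt.
by rewrite /mbinom (bigD1 i) //= bin_small.
Qed.

(** Since [mbinom a b] vanishes unless [b <= a], the sum may run over the support of p. This range
    no longer depends on a, so the sums over a and b can be exchanged. *)
Lemma bernstein_coeffE (p : {mpoly R[n]}) (a : 'X_{1..n}) :
  bernstein_coeff k p a =
  \sum_(b <- msupp p) (mbinom a b)%:R / (mbinom k b)%:R * p@_b.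
Proof.
rewrite [RHS](bigID (fun b => b <= a)%MM) /=.
rewrite [X in _ + X]big1 ?addr0; last first.
  by move=> b /mbinom_eq0->; rewrite !mul0r.
rewrite (big_mksub_cond 'X_{1..n < (mdeg a).+1}) ?msupp_uniq //=; last first.
  by move=> b _ ba; rewrite ltnS leq_mdeg.
rewrite big_mkcondr /=; apply: eq_bigr => b _.
by case: ifPn => // /memN_msupp_eq0->; rewrite mulr0.
Qed.

Lemma meval_mbern (p : {mpoly R[n]}) :
  {in msupp p, forall b, b <= k}%MM ->
  p.@[x] = \sum_f bernstein_coeff k p (mnm_of_ffun f) * mbern f.
Proof.
move=> pk; rewrite mevalE.
under [RHS]eq_bigr do rewrite bernstein_coeffE mulr_suml.
rewrite exchange_big /=; apply: eq_big_seq => b /pk /mexpr_mbern ->.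
by rewrite mulr_sumr; apply: eq_bigr => f _; ring.
Qed.

End Bernstein.

Section Coefficients.
Variables (R : realFieldType) (n m : nat).

Definition mnm_inx (b : 'X_{1..n}) : 'X_{1..n + m} :=
  [multinom (match split i with inl i' => b i' | inr _ => 0%N end) | i < n + m].

Lemma mnm_inx_lshift b i : mnm_inx b (lshift m i) = b i.
Proof. by rewrite mnmE (unsplitK (inl i)). Qed.

Lemma mnm_inx_rshift b j : mnm_inx b (rshift n j) = 0%N.
Proof. by rewrite mnmE (unsplitK (inr j)). Qed.

Lemma mnm_inx_inj : injective mnm_inx.
Proof.
by move=> b1 b2 E; apply/mnmP => i; rewrite -!mnm_inx_lshift E.
Qed.

Lemma inxE (p : {mpoly R[n]}) :
  inx m p = \sum_(b <- msupp p) p@_b *: 'X_[mnm_inx b].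
Proof.
rewrite /inx comp_mpolyE; apply: eq_bigr => b _; congr (_ *: _).
rewrite mpolyXE_id big_split_ord /= [X in _ * X]big1 ?mulr1.
  by apply: eq_bigr => i _; rewrite tnth_mktuple mnm_inx_lshift.
by move=> j _; rewrite mnm_inx_rshift.
Qed.

Lemma mcoeff_inx (p : {mpoly R[n]}) b : (inx m p)@_(mnm_inx b) = p@_b.
Proof.
rewrite inxE [in RHS](mpolyE p) !raddf_sum /=; apply: eq_bigr => b' _.
by rewrite !mcoeffZ !mcoeffX (inj_eq mnm_inx_inj).
Qed.

Lemma meval_inx (p : {mpoly R[n]}) (x : 'I_n -> R) (e : 'I_m -> R) :
  (inx m p).@[point x e] = p.@[x].
Proof.
rewrite comp_mpoly_meval; apply: meval_eq => i.
by rewrite tnth_mktuple mevalXU /point (unsplitK (inl i)).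
Qed.

(** Different summands share no monomial, because each carries its own error variable; hence no
    cancellation occurs. *)
Lemma mcoeff_linear_form (s : 'I_m -> {mpoly R[n]}) b j :
  (\sum_j' inx m (s j') * 'X_(rshift n j'))@_(U_(rshift n j) + mnm_inx b) =
  (s j)@_b.
Proof.
rewrite raddf_sum /= (bigD1 j) //= mcoeffMX mcoeff_inx big1 ?addr0 // => j' j'j.
rewrite inxE mulr_suml raddf_sum /= big1 // => b' _.
rewrite -scalerAl -mpolyXD mcoeffZ mcoeffX; case: eqP; rewrite ?mulr0 //.
(* The exponents of the error variable j' differ: 1 on the left, 0 on the right. *)
move/mnmP/(_ (rshift n j')); rewrite !mnmDE !mnm1E !mnm_inx_rshift eqxx.
by rewrite (inj_eq (@rshift_inj _ _)) eq_sym (negPf j'j).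
Qed.

(** Transfers a multi-degree bound on the whole form to each coefficient: the monomial [x^b e_j]
    survives in the form, so its exponents enter the maxima. *)
Lemma msupp_linear_form (s : 'I_m -> {mpoly R[n]}) b j : b \in msupp (s j) ->
  (b <= multidegree_x (\sum_j' inx m (s j') * 'X_(rshift n j')))%MM.
Proof.
rewrite mcoeff_msupp -mcoeff_linear_form -mcoeff_msupp => bs.
apply/mnm_lepP => i; rewrite mnmE.
apply: leq_trans (leq_bigmax_seq _ bs isT).
by rewrite mnmDE mnm_inx_lshift leq_addl.
Qed.

End Coefficients.

Theorem lemma1 (R : realFieldType) (n q : nat) (c : 'I_q -> R) (t : expr n q)
    (k : 'X_{1..n}) (hk : (multidegree_x (lin_part c t) <= k)%MM)
    (x : 'I_n -> R) (hx : forall i, 0 <= x i <= 1)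
    (e : 'I_(nerr t) -> R) (he : forall j, -1 <= e j <= 1) :
  lower_bound c t k <= (lin_part c t).@[point x e] <= upper_bound c t k.
Proof.
rewrite /lower_bound -ler_norml.
(* The total degree of k gives a common bound N for all coordinates. *)
have kN i : (k i < (mdeg k).+1)%N by rewrite ltnS mdegE (bigD1 i) //= leq_addr.
have sk (j : 'I_(nerr t)) : {in msupp (s_poly c j), forall b, b <= k}%MM.
  by move=> b /msupp_linear_form bs; exact: lepm_trans bs hk.
pose T (f : {ffun 'I_n -> 'I_(mdeg k).+1}) :=
  \sum_(j < nerr t) `|bernstein_coeff k (s_poly c j) (mnm_of_ffun f)|.
apply: (@le_trans _ _ (\sum_f T f * mbern k x f)); last first.
  rewrite -[upper_bound _ _ _]mulr1 -(sum_mbern x kN) mulr_sumr.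
  apply: ler_sum => f _.
  (* Outside [alpha <= k] the maximum says nothing about [T f], but the weight is 0. *)
  have [fk|/mbern_eq0->] := boolP (mnm_of_ffun f <= k)%MM; last first.
    by rewrite !mulr0.
  rewrite ler_wpM2r ?mbern_ge0 //.
  have fN : (mdeg (mnm_of_ffun f) < (mdeg k).+1)%N.
    by rewrite ltnS leq_mdeg.
  exact: (@le_bigmax_cond _ _ _ 0 (BMultinom fN) _
    (fun a : 'X_{1..n < _} =>
       \sum_(j < nerr t) `|bernstein_coeff k (s_poly c j) a|) fk).
rewrite raddf_sum /=; apply: le_trans (ler_norm_sum _ _ _) _.
under [X in _ <= X]eq_bigr do rewrite mulr_suml.
rewrite exchange_big /=; apply: ler_sum => j _.
rewrite mevalM meval_inx mevalXU /point (unsplitK (inr j)) normrM.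
(* The factor [e j] is dropped since its absolute value is at most 1. *)
apply: (@le_trans _ _ `|(s_poly c j).@[x]|).
  by rewrite ler_piMr // ler_norml.
rewrite (meval_mbern x kN (sk j)); apply: le_trans (ler_norm_sum _ _ _) _.
by apply: ler_sum => f _; rewrite normrM (ger0_norm (mbern_ge0 _ _ hx)).
Qed.
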